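(* Let $G=(V,E)$ be a finite graph with a fixed total ordering of its edges. The Hasse diagram of the Boolean lattice $2^E$ has an acyclic matching $\mathrm{M}_{\mathrm{BC}}$ in which each matched pair $S\lessdot S'$ satisfies $k(S)=k(S')$ and $\lambda(S)=\lambda(S')$, and whose set of critical (unmatched) vertices is $\mathrm{M}_{\mathrm{BC}}^0=\mathrm{NBC}$.
   Context: A finite graph $G=(V,E)$ consists of a finite set $V$ and a set $E$ of 2-element subsets of $V$. A cycle is (the edge set of) a closed sequence $x_1,\dots,x_k,x_1$ with $k\ge 3$, $x_1,\dots,x_k$ distinct vertices and each $\{x_i,x_{i+1}\}$ an edge (indices mod $k$). Fix an ordering $e_1,\dots,e_m$ of $E$. A broken circuit is a set $C\setminus\{e\}$ where $C\subseteq E$ is a cycle and $e$ is the edge of $C$ with the largest label. $\mathrm{NBC}$ is the set of all $S\subseteq E$ that contain no broken circuit. A subset $S\subseteq E$ is identified with the spanning subgraph with vertex set $V$ and edge set $S$; $k(S)$ is its number of connected components and $\lambda(S)$ is the set partition of $V$ into the connected components of $S$. $2^E$ is the poset of subsets of $E$ ordered by inclusion; $S\lessdot S'$ denotes a cover relation. Its Hasse diagram is the directed graph with vertex set $2^E$ and an edge $S\to S'$ whenever $S\lessdot S'$. A matching $M$ on a directed graph is a collection of pairwise disjoint edges; it is acyclic if reversing the direction of all edges in $M$ produces a directed graph with no directed cycles; $M^0$ is the set of vertices not incident with any edge of $M$. *)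

(* Defs.v *)
From mathcomp Require Import all_boot.

Set Implicit Arguments.
Unset Strict Implicit.
Unset Printing Implicit Defensive.

(* A digraph whose vertices form a finite subset of an ambient finType. *)
Record digraph (T : finType) := Digraph {
  dverts : {set T};
  darcs : {set T * T};
  darcs_sub : darcs \subset setX dverts dverts
}.

Section Matching.
Variables (T : finType) (D : digraph T).
Implicit Types (M : {set T * T}) (p : T * T).

Definition endpoints p : {set T} := [set p.1; p.2].

Definition matching M : Prop :=
  M \subset darcs D /\
  {in M &, forall p q, p != q -> [disjoint endpoints p & endpoints q]}.

Definition reversed_arcs M : {set T * T} :=
  (darcs D :\: M) :|: [set (p.2, p.1) | p in M].

(* [ucycle] holds of the empty sequence, which is not a directed cycle. *)
Definition acyclic_matching M : Prop :=
  matching M /\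
  ~ exists c : seq T,
      c <> [::] /\ ucycle [rel x y | (x, y) \in reversed_arcs M] c.

Definition critical M : {set T} :=
  [set x in dverts D | [forall p in M, x \notin endpoints p]].

End Matching.

Section Boolean.
Variables (T : finType) (E : {set T}).

Definition powerset_covers (S S' : {set T}) : bool :=
  (S \proper S') &&
  [forall X in powerset E, ~~ ((S \proper X) && (X \proper S'))].

Definition hasse_arcs : {set {set T} * {set T}} :=
  [set p in setX (powerset E) (powerset E) | powerset_covers p.1 p.2].

Lemma hasse_arcs_sub : hasse_arcs \subset setX (powerset E) (powerset E).
Proof. by apply/subsetP=> p; rewrite inE => /andP[]. Qed.

Definition boolean_hasse : digraph {set T} := Digraph hasse_arcs_sub.

End Boolean.

Section Graph.
Variable V : finType.
Implicit Types (E S C B : {set {set V}}) (s : seq {set V}).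

(* The graph with vertex set V and edge set E. *)
Definition simple_graph E : Prop := {in E, forall e : {set V}, #|e| = 2}.

Definition adj S : rel V := [rel u v | [set u; v] \in S].

Definition num_components S : nat := n_comp (adj S) V.

Definition component_partition S : {set {set V}} :=
  equivalence_partition (connect (adj S)) [set: V].

Definition is_cycle E C : Prop :=
  exists x : seq V,
    [/\ 3 <= size x, ucycle (adj E) x &
        C = [set [set v; next x v] | v in x]].

(* The sequence s lists e_1, ..., e_m; the label of e is [index e s], so labels
   start at 0. *)
Definition edge_ordering E s : Prop := uniq s /\ s =i E.

Definition broken_circuit E s B : Prop :=
  exists C (e : {set V}),
    [/\ is_cycle E C, e \in C,
        {in C, forall f, index f s <= index e s} & B = C :\ e].

Definition NBC E s S : Prop :=
  S \subset E /\ forall B, broken_circuit E s B -> ~ (B \subset S).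

End Graph.

(* Main.v *)
(** Call an edge e active for S when S contains C minus e for some cycle C whose
    largest edge is e; then S is in NBC iff no edge is active for S. Whether e is
    active depends only on the edges of S smaller than e, so toggling the smallest
    active edge of S (its pivot) does not change the pivot, and pairing S with its
    toggle is a matching with critical set NBC. The ends of an active edge are
    joined in S by the rest of the cycle, so the components are preserved.
    For acyclicity, attach to S its indicator word along the edge order, with the
    bit of the pivot flipped: every arc of the modified Hasse diagram, be it an
    unmatched arc upwards or a matched arc downwards, strictly increases this word
    lexicographically. *)
Require Import Defs.
From mathcomp Require Import all_boot.

Set Implicit Arguments.
Unset Strict Implicit.
Unset Printing Implicit Defensive.

(** Any [i] in [Y] outside [X] puts [i |: X] strictly above [X] and inside [Y], so a cover forces
    equality; conversely, cardinality leaves no room between. *)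
Lemma hasse_arcP (T : finType) (E X Y : {set T}) :
  reflect (exists i, [/\ X \subset E, i \in E, i \notin X & Y = i |: X])
          ((X, Y) \in hasse_arcs E).
Proof.
apply: (iffP idP) => [|[i [sXE Ei nXi ->]]].
  rewrite !inE /= => /andP[/andP[sXE sYE] /andP[/properP[sXY [i Yi nXi]] /forallP cov]].
  have Ei : i \in E by apply: (subsetP sYE).
  exists i; split=> //; apply/esym/eqP; rewrite eqEproper subUset sub1set Yi sXY /=.
  have := cov (i |: X); rewrite powersetE subUset sub1set Ei sXE /=.
  by rewrite properUr ?sub1set // => /negbTE ->.
rewrite !inE /= sXE subUset sub1set Ei sXE /=; apply/andP; split.
  by rewrite properUr // sub1set.
apply/forall_inP=> Z _; apply/negP=> /andP[ltXZ ltZY].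
have := leq_ltn_trans (proper_card ltXZ) (proper_card ltZY).
by rewrite cardsU1 nXi ltnn.
Qed.

(** * Toggling the pivot, for an abstract local notion of activity *)

Section PivotMatching.
Variables (T : finType) (E : {set T}) (s : seq T) (act : {set T} -> pred T).
Implicit Types (X Y Z : {set T}) (i j : T).

Hypothesis sE : s =i E.
Hypothesis actE : forall X i, act X i -> i \in E.

Definition agree_below i X Y :=
  forall j, index j s < index i s -> (j \in X) = (j \in Y).

Hypothesis act_local : forall X Y i, agree_below i X Y -> act X i -> act Y i.

Lemma agree_belowC i X Y : agree_below i X Y -> agree_below i Y X.
Proof. by move=> agr j /agr. Qed.

Lemma agree_belowU i X : agree_below i X (i |: X).
Proof. by move=> j; rewrite in_setU1; case: eqP => // ->; rewrite ltnn. Qed.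

Definition pivot X i := act X i && [forall j, act X j ==> (index i s <= index j s)].

Lemma pivot_act X i : pivot X i -> act X i. Proof. by case/andP. Qed.

Lemma pivot_inE X i : pivot X i -> i \in E. Proof. by move/pivot_act/actE. Qed.

Lemma pivot_uniq X i j : pivot X i -> pivot X j -> i = j.
Proof.
move=> pi pj; apply: (@index_inj _ i s); rewrite ?sE ?(pivot_inE pi) ?(pivot_inE pj) //.
case/andP: pi pj => ai /forallP mini /andP[aj /forallP minj].
apply/eqP; rewrite eqn_leq.
by rewrite (implyP (mini j)) // (implyP (minj i)).
Qed.

Lemma pivot_ex X i : act X i -> exists j, pivot X j.
Proof.
move=> ai; case: (arg_minnP (index^~ s) ai) => j aj minj.
by exists j; rewrite /pivot aj; apply/forall_inP.
Qed.

(** An active element of [Y] below [i] would, by locality, be active for [X] as well, against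
    minimality. *)
Lemma pivot_local X Y i : agree_below i X Y -> pivot X i -> pivot Y i.
Proof.
move=> agr /andP[ai /forall_inP mini]; rewrite /pivot (act_local agr ai) /=.
apply/forall_inP=> j aj; rewrite leqNgt; apply/negP=> ltji.
have /mini: act X j.
  by apply: act_local aj => k ltkj; rewrite agr // (ltn_trans ltkj).
by rewrite leqNgt ltji.
Qed.

Lemma eq_pivot X Y i : agree_below i X Y -> pivot X i = pivot Y i.
Proof.
by move=> agr; apply/idP/idP; apply: pivot_local => //; apply: agree_belowC.
Qed.

Definition pivot_matching : {set {set T} * {set T}} :=
  [set p | [exists i, [&& pivot p.1 i, p.1 \subset E, i \notin p.1 & p.2 == i |: p.1]]].

Lemma pivot_matchingP X Y :
  reflect (exists i, [/\ pivot X i, X \subset E, i \notin X & Y = i |: X])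
          ((X, Y) \in pivot_matching).
Proof.
rewrite inE /=; apply: (iffP existsP) => -[i].
  by case/and4P=> *; exists i; split=> //; apply/eqP.
by case=> *; exists i; apply/and4P; split=> //; apply/eqP.
Qed.

(** Toggling [i] changes nothing below [i], so both ends have pivot [i], and either end determines
    the whole pair. *)
Lemma pivot_matching_endpoint p Z : p \in pivot_matching -> Z \in endpoints p ->
  exists2 i, pivot Z i & p = (Z :\ i, i |: Z).
Proof.
case: p => X Y /pivot_matchingP[i [pi sXE nXi ->]]; rewrite !inE /=.
case/orP=> /eqP->; exists i => //.
- by congr (_, _); apply/setP=> j; rewrite !inE; case: eqP nXi => // -> /negbTE.
- by rewrite -(eq_pivot (@agree_belowU i X)).
- by rewrite setU1K // setUA setUid.
Qed.

Lemma matching_pivot : matching (boolean_hasse E) pivot_matching.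
Proof.
split.
  apply/subsetP=> -[X Y] /pivot_matchingP[i [pi sXE nXi ->]].
  by apply/hasse_arcP; exists i; split=> //; apply: pivot_inE pi.
move=> p q Mp Mq; apply: contraNT => /pred0Pn[Z /andP[/= Zp Zq]].
have [i pi ->] := pivot_matching_endpoint Mp Zp.
have [j pj ->] := pivot_matching_endpoint Mq Zq.
by rewrite (pivot_uniq pi pj).
Qed.

Lemma critical_pivotP X :
  reflect (X \subset E /\ forall i, ~~ act X i)
          (X \in critical (boolean_hasse E) pivot_matching).
Proof.
rewrite inE powersetE; apply: (iffP andP) => -[sXE].
  move/forall_inP=> crit; split=> // i; apply/negP=> /pivot_ex[{}i pi].
  have /crit: (X :\ i, i |: X) \in pivot_matching.
    apply/pivot_matchingP; exists i; split; rewrite ?setD11 //.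
    (* Adding [i] to both sides avoids deciding whether [X] contains it: [X :\ i] and [X] have the
       same union with [i]. *)
    - rewrite (eq_pivot (@agree_belowU i _)).
      rewrite (_ : i |: X :\ i = i |: X) -?(eq_pivot (@agree_belowU i _)) //.
      by apply/setP=> j; rewrite !inE; case: eqP.
    - by apply: subset_trans sXE; rewrite subsetDl.
    - by apply/setP=> j; rewrite !inE; case: eqP.
  rewrite !inE /=; case: (boolP (i \in X)) => Xi.
    by rewrite [X == i |: X]eq_sym (setUidPr _) ?sub1set // eqxx orbT.
  by rewrite [X == X :\ i]eq_sym (setDidPl _) ?eqxx // disjoint_sym disjoints1.
move=> nact; split=> //; apply/forall_inP=> p Mp; apply/negP=> Xp.
have [i /pivot_act ai _] := pivot_matching_endpoint Mp Xp.
by have := nact i; rewrite ai.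
Qed.

(** * Lexicographic order and acyclicity *)

Definition pivot_bit X i := (i \in X) (+) pivot X i.

Definition pivot_lt : rel {set T} := fun X Y =>
  [exists i in E, [&& ~~ pivot_bit X i, pivot_bit Y i &
    [forall j, (index j s < index i s) ==> (pivot_bit X j == pivot_bit Y j)]]].

Lemma pivot_lt_irr X : pivot_lt X X = false.
Proof. by apply/existsP=> -[i /and4P[_ /negP ]]. Qed.

Lemma pivot_lt_trans : transitive pivot_lt.
Proof.
move=> Y X Z /exists_inP[i Ei /and3P[Xi Yi /forall_inP XY]].
move=> /exists_inP[j Ej /and3P[Yj Zj /forall_inP YZ]].
apply/exists_inP; case: (ltngtP (index i s) (index j s)) => [ltij|ltji|eqij].
- exists i => //; apply/and3P; split; rewrite -?(eqP (YZ i ltij)) //.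
  apply/forall_inP=> k lt_ki; rewrite (eqP (XY k lt_ki)).
  exact: YZ (ltn_trans lt_ki ltij).
- exists j => //; apply/and3P; split; rewrite ?(eqP (XY j ltji)) //.
  apply/forall_inP=> k lt_kj; rewrite -(eqP (YZ k lt_kj)).
  exact: XY (ltn_trans lt_kj ltji).
(* A common first difference is impossible: the entry of [Y] there would be both true and false. *)
- have eq_ij : i = j by apply: (@index_inj _ i s); rewrite ?sE.
  by rewrite eq_ij (negbTE Yj) in Yi.
Qed.

Lemma agree_below_bit i X Y j :
  agree_below i X Y -> index j s < index i s -> pivot_bit X j = pivot_bit Y j.
Proof.
move=> agr ltji; rewrite /pivot_bit agr //; congr (_ (+) _); apply: eq_pivot.
by move=> k ltkj; rewrite agr // (ltn_trans ltkj).
Qed.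

Lemma reversed_pivot_lt X Y :
  (X, Y) \in reversed_arcs (boolean_hasse E) pivot_matching -> pivot_lt X Y.
Proof.
rewrite !in_setU in_setD => /orP[/andP[nM /hasse_arcP[i [sXE Ei nXi defY]]]|].
  (* Unmatched arc upwards: the added [i] is not the pivot, so its entry is its membership bit,
     going from 0 to 1. *)
  have npi : ~~ pivot X i.
    by apply: contra nM => pi; apply/pivot_matchingP; exists i.
  rewrite defY; apply/exists_inP; exists i => //; apply/and3P; split.
  - by rewrite /pivot_bit (negbTE nXi) (negbTE npi).
  - by rewrite /pivot_bit setU11 -(eq_pivot (@agree_belowU i X)) (negbTE npi).
  - by apply/forall_inP=> j /(agree_below_bit (@agree_belowU i X))->.
(* Reversed arc: [i] is removed, but as the pivot of both ends its bit is flipped, so its entry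
   again goes from 0 to 1. *)
case/imsetP=> -[Y' X'] /pivot_matchingP[i [pi _ nYi ->]] [-> ->].
apply/exists_inP; exists i; first exact: pivot_inE pi.
apply/and3P; split.
- by rewrite /pivot_bit setU11 -(eq_pivot (@agree_belowU i Y')) pi.
- by rewrite /pivot_bit (negbTE nYi) pi.
- by apply/forall_inP=> j /(agree_below_bit (@agree_belowU i Y'))->.
Qed.

Lemma acyclic_pivot : acyclic_matching (boolean_hasse E) pivot_matching.
Proof.
split; first exact: matching_pivot.
case=> -[|X c] [] // _ /andP[/= cyc _].
have /(order_path_min pivot_lt_trans)/allP/(_ X): path pivot_lt X (rcons c X).
  by apply: sub_path cyc => Y Z; apply: reversed_pivot_lt.
by rewrite mem_rcons mem_head pivot_lt_irr => /(_ isT).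
Qed.

End PivotMatching.

(** * Connectivity and cycle edges *)

Section Components.
Variable V : finType.
Implicit Types (E S C : {set {set V}}) (e : {set V}) (s : seq {set V}).

Lemma adj_sym S : symmetric (adj S).
Proof. by move=> u v; rewrite /adj /= setUC. Qed.

Lemma connect_adj_sym S : connect_sym (adj S).
Proof. exact/sym_connect_sym/adj_sym. Qed.

Lemma connect_adjU1 S u v :
  connect (adj S) u v -> connect (adj S) =2 connect (adj ([set u; v] |: S)).
Proof.
move=> uv x y; apply/idP/idP; apply: connect_sub => {x y} x y.
  by move=> xy; apply: connect1; rewrite /adj /= in_setU1 [_ \in S]xy orbT.
rewrite /adj /= in_setU1 => /orP[/eqP eqe|xy]; last exact: connect1.
(* [u = v] is not excluded here, so the degenerate case is split off first. *)
have [->|neq_xy] := eqVneq x y; first exact: connect0.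
have: x \in [set u; v] by rewrite -eqe set21.
have: y \in [set u; v] by rewrite -eqe set22.
case/set2P=> ? /set2P[] ?; subst=> //; rewrite ?eqxx // in neq_xy *.
by rewrite connect_adj_sym.
Qed.

Lemma eq_component_partition S S' : connect (adj S) =2 connect (adj S') ->
  component_partition S = component_partition S'.
Proof. by move=> eqc; apply: eq_imset => x; apply/setP=> y; rewrite !inE eqc. Qed.

Lemma eq_num_components S S' : connect (adj S) =2 connect (adj S') ->
  num_components S = num_components S'.
Proof. by move=> eqc; apply: eq_n_comp. Qed.

Lemma cycle_minus_edge_connect E C e S : is_cycle E C -> e \in C -> C :\ e \subset S ->
  exists u v, e = [set u; v] /\ connect (adj S) u v.
Proof.
case=> x [szx /andP[_ Ux] ->] /imsetP[v xv ->] /subsetP sCS.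
exists v, (next x v); split=> //; rewrite connect_adj_sym.
(* The cycle is rotated to start at the successor [w] of [v]; it then ends at [v], and reading it in
   order avoids the edge from [v] to [w]. *)
have [k p defp] := rot_to (etrans (mem_next x v) xv).
set w := next x v in sCS defp *.
have Up : uniq (w :: p) by rewrite -defp rot_uniq.
have fp : fcycle (next x) (w :: p) by rewrite -defp rot_cycle cycle_next.
have sx : {subset w :: p <= x} by move=> z; rewrite -defp mem_rot.
have defv : v = last w p.
  apply: (can_inj (prev_next Ux)).
  by move: fp; rewrite /= rcons_path => /andP[_ /eqP->].
have szp : 1 < size p by move: szx; rewrite -(size_rot k) defp.
have arc a b : a \in x -> next x a = b -> [set a; b] != [set v; w] ->
  adj S a b.
  move=> xa <- neq; apply: sCS; rewrite in_setD1 neq.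
  by apply/imsetP; exists a.
(* Length at least 3 gives a vertex [c] strictly between [w] and [v]; [q] may be empty. *)
case/lastP: p => [|[|c q] z] // in defp Up fp sx defv szp *.
rewrite last_rcons in defv; rewrite -{z}defv in defp Up fp sx szp *.
apply/connectP; exists (c :: rcons q v); last by rewrite /= last_rcons.
move: fp Up; rewrite /= rcons_path => /and3P[/eqP nwc fq _].
rewrite !(inE, mem_rcons) !negb_or rcons_uniq.
case/and3P=> /and3P[neq_wc neq_wv nqw] /andP[neq_cv nqc] /andP[nqv Uq].
apply/andP; split.
  apply: arc => //; first by apply: sx; rewrite mem_head.
  apply/eqP=> /setP/(_ v); rewrite !inE eqxx /=.
  by rewrite [v == w]eq_sym [v == c]eq_sym (negbTE neq_wv) (negbTE neq_cv).
have sub : {in c :: q, forall a, [/\ a \in x, a != v & a != w]}.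
  move=> a; rewrite inE => qa; split.
  - by apply: sx; rewrite !(inE, mem_rcons); case/orP: qa => ->; rewrite !orbT.
  - by case/orP: qa => [/eqP->//|qa]; apply: contraNneq nqv => <-.
  - by case/orP: qa => [/eqP->|qa]; [rewrite eq_sym | apply: contraNneq nqw => <-].
(* Such an edge contains [a], which is neither [v] nor [w], so it is not the removed edge. *)
have arc_sub a b : a \in c :: q -> next x a = b -> adj S a b.
  case/sub=> xa neq_av neq_aw ab; apply: (arc _ _ xa ab).
  by apply/eqP=> /setP/(_ a); rewrite !inE eqxx (negbTE neq_av) (negbTE neq_aw).
apply/(pathP v)=> i lti; apply: arc_sub; last exact/eqP/(pathP v fq).
by rewrite -rcons_cons nth_rcons /= -(size_rcons q v) lti mem_nth //= -(size_rcons q v).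
Qed.

(* A cycle visits each vertex at most once, so finitely many sequences suffice. *)
Definition cycleb E C :=
  [exists n : 'I_#|V|.+1, exists x : n.-tuple V,
    [&& 2 < size x, ucycleb (adj E) x & C == [set [set v; next x v] | v in tval x]]].

Lemma cycleP E C : reflect (is_cycle E C) (cycleb E C).
Proof.
apply: (iffP existsP) => [[n /existsP[x /and3P[? ? /eqP ?]]]|[x [szx ucx defC]]].
  by exists x.
have szn : size x < #|V|.+1.
  by case/andP: ucx => _ /card_uniqP <-; rewrite ltnS max_card.
exists (Ordinal szn); apply/existsP; exists (in_tuple x).
by apply/and3P; split=> //; apply/eqP.
Qed.

(** * Active edges and broken circuits *)

Lemma is_cycle_sub E C : is_cycle E C -> C \subset E.
Proof.
case=> x [_ /andP[cx _] ->]; apply/subsetP=> _ /imsetP[v xv ->].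
exact: (next_cycle cx xv).
Qed.

(** Boolean by way of [cycleb], so that it can serve as the predicate [act] of the pivot
    matching. *)
Definition active E s S e :=
  [exists C, [&& cycleb E C, e \in C, [forall f in C, index f s <= index e s]
    & C :\ e \subset S]].

Lemma activeP E s S e :
  reflect (exists C, [/\ is_cycle E C, e \in C,
             {in C, forall f, index f s <= index e s} & C :\ e \subset S])
          (active E s S e).
Proof.
apply: (iffP existsP) => -[C].
  by case/and4P=> /cycleP ? ? /forall_inP ? ?; exists C.
by case=> /cycleP ? ? ? ?; exists C; apply/and4P; split=> //; apply/forall_inP.
Qed.

Lemma active_inE E s S e : active E s S e -> e \in E.
Proof. by case/activeP=> C [/is_cycle_sub/subsetP sCE /sCE]. Qed.

(** Labels are injective on [E], so every edge of the cycle other than its largest edge [e] lies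
    strictly below [e], where [S] and [S'] agree. *)
Lemma active_local E s S S' e : s =i E ->
  agree_below s e S S' -> active E s S e -> active E s S' e.
Proof.
move=> sE agr /activeP[C [cC Ce maxe /subsetP sCS]].
apply/activeP; exists C; split=> //; apply/subsetP=> f CDf.
have /subsetP sCE := is_cycle_sub cC.
have /setD1P[neq_fe Cf] := CDf.
rewrite -agr ?sCS // ltn_neqAle maxe // andbT; apply: contraNneq neq_fe.
by move/(index_inj e)->; rewrite // sE sCE.
Qed.

Lemma NBC_activeP E s S : NBC E s S <-> S \subset E /\ forall e, ~~ active E s S e.
Proof.
split=> -[sSE nbc]; split=> //.
  move=> e; apply/negP=> /activeP[C [cC Ce maxe]]; apply: nbc.
  by exists C, e.
move=> _ [C [e [cC Ce maxe ->]]] sCS.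
by have /activeP[] := nbc e; exists C.
Qed.

End Components.

Theorem lemma4p3 (V : finType) (E : {set {set V}}) (hE : simple_graph E)
    (s : seq {set V}) (hs : edge_ordering E s) :
  exists M : {set {set {set V}} * {set {set V}}},
    [/\ acyclic_matching (boolean_hasse E) M,
        forall S S' : {set {set V}}, (S, S') \in M ->
          num_components S = num_components S' /\
          component_partition S = component_partition S' &
        forall S : {set {set V}},
          S \in critical (boolean_hasse E) M <-> NBC E s S].
Proof.
case: hs => _ sE.
have actE := @active_inE V E s.
have actL S S' e := @active_local V E s S S' e sE.
exists (pivot_matching E s (active E s)); split.
- exact: acyclic_pivot.
(* The added edge is active for [S], hence joins two vertices already connected in [S]. *)
- move=> S S' /pivot_matchingP[e [/pivot_act/activeP[C [cC Ce _ sCS]] _ _ ->]].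
  have [u [v [-> uv]]] := cycle_minus_edge_connect cC Ce sCS.
  have eqc := connect_adjU1 uv.
  by split; [apply: eq_num_components | apply: eq_component_partition].
- move=> S; split.
    by move/(critical_pivotP E actL)/NBC_activeP.
  by move/NBC_activeP/(critical_pivotP E actL).
Qed.
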